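(* Suppose that for some nonzero $m\in\mathbb{Z}$, some $u,v\in\mathbb{Q}$ and some constant $\lambda$ the identity $$\sum_{n=0}^{\infty}(un+v)\frac{\mathrm{Domb}(n)}{m^n}=\frac{\lambda}{\pi}$$ holds. Then for any nonconstant polynomial $P(n)\in\mathbb{Q}[n]$, there exist a nonzero polynomial $Q(n)\in\mathbb{Q}[n]$ with $\deg Q(n)\leq 2$ and a constant $c\in\mathbb{Q}$ such that $$\sum_{n=0}^{\infty}P(n)Q(n)\frac{\mathrm{Domb}(n)}{m^n}=\frac{c\lambda}{\pi}.$$
   Context: The Domb numbers are $\mathrm{Domb}(n)=\sum_{k=0}^n \binom{n}{k}^2\binom{2k}{k}\binom{2(n-k)}{n-k}$ for $n\ge 0$.
   Formalization: The formal theorem additionally assumes that u and v are not both zero and that m is neither 16 nor -16; without these the claim fails, e.g. for u=v=λ=0, m=1, or for m=16, u=0, v=1, where the concluding series diverges. *)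

(* Defs.v *)
From mathcomp Require Import all_boot.

Set Implicit Arguments.
Unset Strict Implicit.
Unset Printing Implicit Defensive.

Definition Domb (n : nat) : nat :=
  \sum_(k < n.+1) 'C(n, k) ^ 2 * 'C(2 * k, k) * 'C(2 * (n - k), n - k).

Example Domb_values : [seq Domb n | n <- iota 0 5] = [:: 1; 4; 28; 256; 2716].
Proof. by rewrite /= /Domb !big_ord_recr !big_ord0. Qed.

(* Main.v *)
(* Write a(n) = Domb(n) / m^n.  The Domb numbers satisfy a second-order recurrence
   with cubic coefficients; summing it against a polynomial x of degree d and
   reindexing shows that the functional f |-> \sum_n f(n) a(n) kills a polynomial
   Lx of degree d + 3 whose leading coefficient is (m - 4)(m - 16) times that of x.
   Since Domb(n) lies between 16^n / (2n+1)^3 and 16^n, convergence of the given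
   series forces |m| > 16, so that all these series converge and the leading
   coefficient of Lx does not vanish.  Hence every polynomial is congruent, modulo
   the kernel of the functional, to one of degree at most 2.  Reducing P, P X and
   P X^2 in this way and adding u X + v gives four vectors in a space of dimension
   three; a linear relation between them is the required Q and c. *)
Require Import Defs.
From mathcomp Require Import all_boot all_order all_algebra.
From mathcomp Require Import all_classical all_reals all_analysis.
From mathcomp Require Import ring lra zify.

Set Implicit Arguments.
Unset Strict Implicit.
Unset Printing Implicit Defensive.

Import Order.TTheory GRing.Theory Num.Theory.
Import numFieldNormedType.Exports.

Local Open Scope classical_set_scope.
Local Open Scope ring_scope.

(** * Ratios of neighbouring summands, and the recurrence of the Domb numbers *)

Lemma central_binS n :
  (n.+1 * 'C(2 * n.+1, n.+1) = 2 * (2 * n + 1) * 'C(2 * n, n))%N.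
Proof.
have e0 : (2 * n.+1 = (2 * n).+2)%N by lia.
have := mul_bin_diag (2 * n).+1 n; have := mul_bin_down (2 * n).+1 n.
have e3 : ((2 * n).+1 - n = n.+1)%N by lia.
rewrite e0 e3 /= [in X in _ -> _ -> X]binS mulnDr => <- <-; lia.
Qed.

Lemma central_binS_rat n :
  (n%:R + 1) * 'C(2 * n.+1, n.+1)%:R =
  2 * (2 * n%:R + 1) * 'C(2 * n, n)%:R :> rat.
Proof.
have /(congr1 (fun x => x%:R : rat)) := central_binS n.
by rewrite !natrM natrD natrM natr1.
Qed.

Definition domb_term (n k : nat) : rat :=
  ('C(n, k) ^ 2 * 'C(2 * k, k) * 'C(2 * (n - k), n - k))%:R.

Lemma domb_term_small n k : (n < k)%N -> domb_term n k = 0.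
Proof. by move=> nk; rewrite /domb_term bin_small. Qed.

(** An odd integer is never zero, even when [b] exceeds [a]; this keeps the denominators of
    [domb_cert] and of the term ratios nonzero. *)
Lemma oddr_neq0 (a b : nat) : 2 * (a%:R - b%:R) - 1 != 0 :> rat.
Proof.
have -> : 2 * (a%:R - b%:R) - 1 = (2 * (Posz a - Posz b) - 1)%:~R :> rat.
  by rewrite rmorphB rmorphM rmorphB.
by rewrite intr_eq0; apply/eqP; lia.
Qed.

(** The squared ratio of ['C(n, k)] to ['C(n.+1, k)] gives two factors of the cube and the central
    binomial the third; at [k = n.+1] both sides vanish. *)
Lemma domb_term_Sn n k : (k <= n.+1)%N ->
  2 * n.+1%:R ^+ 2 * (2 * (n.+1%:R - k%:R) - 1) * domb_term n k =
  (n.+1%:R - k%:R) ^+ 3 * domb_term n.+1 k.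
Proof.
rewrite leq_eqVlt => /predU1P[->|].
  by rewrite domb_term_small // subrr expr0n mul0r mulr0.
rewrite ltnS => /subnKC; set j := (n - k)%N => en.
rewrite /domb_term -en -addnS !addKn.
have eb : (k%:R + j%:R + 1) * 'C(k + j, k)%:R =
    (j%:R + 1) * 'C(k + j.+1, k)%:R :> rat.
  have /(congr1 (fun x => x%:R : rat)) := mul_bin_down (k + j.+1) k.
  by rewrite addKn addnS /= !natrM -!natr1 natrD.
have ec := central_binS_rat j.
have es : (k + j.+1)%:R = k%:R + j%:R + 1 :> rat by rewrite addnS -natr1 natrD.
rewrite -!mulnn !natrM es; set c := 'C(2 * k, k)%:R.
transitivity (c * ((k%:R + j%:R + 1) * 'C(k + j, k)%:R) ^+ 2 *
  (2 * (2 * j%:R + 1) * 'C(2 * j, j)%:R)); first by ring.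
by rewrite eb -ec; ring.
Qed.

Lemma domb_term_Sk n k : (k <= n)%N ->
  (k%:R + 1) ^+ 3 * (2 * (n%:R - k%:R) - 1) * domb_term n k.+1 =
  (n%:R - k%:R) ^+ 3 * (2 * k%:R + 1) * domb_term n k.
Proof.
rewrite leq_eqVlt => /predU1P[->|].
  by rewrite domb_term_small // subrr expr0n !mul0r mulr0.
move=> /subnKC; set j := (n - k.+1)%N => en.
rewrite /domb_term -en addKn addSnnS addKn.
have eb : (k%:R + 1) * 'C(k + j.+1, k.+1)%:R =
    (j%:R + 1) * 'C(k + j.+1, k)%:R :> rat.
  have := mul_bin_left (k + j.+1) k.
  by rewrite addKn => /(congr1 (fun x => x%:R : rat)); rewrite !natrM -!natr1.
have es : (k + j.+1)%:R = k%:R + j%:R + 1 :> rat by rewrite addnS -natr1 natrD.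
rewrite -!mulnn !natrM es.
transitivity (((k%:R + 1 : rat) * 'C(k + j.+1, k.+1)%:R) ^+ 2 *
  ((k%:R + 1) * 'C(2 * k.+1, k.+1)%:R) * (2 * j%:R + 1)
  * 'C(2 * j, j)%:R); first by ring.
rewrite eb central_binS_rat.
transitivity ((j%:R + 1 : rat) ^+ 2 * 'C(k + j.+1, k)%:R ^+ 2 *
  (2 * k%:R + 1) * 'C(2 * k, k)%:R *
  (2 * (2 * j%:R + 1) * 'C(2 * j, j)%:R)); first by ring.
by rewrite -central_binS_rat; ring.
Qed.

(* Zeilberger certificate for the recurrence [Domb_rec], with the rational
   factor written relative to the term of index n so that its only denominators
   are n and an odd number: it then has no pole at k = n.+1 or beyond. *)
Definition domb_cert (n k : nat) : rat :=
  k%:R ^+ 3 * (10 * n%:R ^+ 2 - 12 * n%:R ^+ 3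
    + (26 * n%:R ^+ 2 - 15 * n%:R) * k%:R + (6 - 18 * n%:R) * k%:R ^+ 2
    + 4 * k%:R ^+ 3) / (n%:R ^+ 2 * (2 * (n%:R - k%:R) - 1)) * domb_term n k.

Lemma domb_cert_telescope n k : (k <= n.+2)%N ->
  (n%:R + 2) ^+ 3 * domb_term n.+2 k
  - 2 * (2 * n%:R + 3) * (5 * (n%:R + 1) ^+ 2 + 5 * (n%:R + 1) + 2)
    * domb_term n.+1 k
  + 64 * (n%:R + 1) ^+ 3 * domb_term n k =
  domb_cert n.+2 k.+1 - domb_cert n.+2 k.
Proof.
move=> kn.
have en1 : n.+1%:R = n%:R + 1 :> rat by rewrite natr1.
have en2 : n.+2%:R = n%:R + 2 :> rat by rewrite -natrD addn2.
have ek1 : k.+1%:R = k%:R + 1 :> rat by rewrite natr1.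
have n1 : n%:R + 1 != 0 :> rat by rewrite -en1 pnatr_eq0.
have n2 : n%:R + 2 != 0 :> rat by rewrite -en2 pnatr_eq0.
have k1 : k%:R + 1 != 0 :> rat by rewrite -ek1 pnatr_eq0.
have d1 := oddr_neq0 n.+1 k.
have d2 := oddr_neq0 n.+2 k.
have d2' := oddr_neq0 n.+2 k.+1.
have e1 := domb_term_Sn kn.
have e3 := domb_term_Sk kn.
(* [domb_term_Sn] at [n] stops at [k = n.+1]; in the remaining case [k = n.+2] both terms are
   zero. *)
have e2 : 2 * n.+1%:R ^+ 2 * (2 * (n.+1%:R - k%:R) - 1) * domb_term n k =
  (n.+1%:R - k%:R) ^+ 3 * domb_term n.+1 k \/
  domb_term n.+1 k = 0 /\ domb_term n k = 0.
  move: kn; rewrite leq_eqVlt => /predU1P[->|].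
    by right; rewrite !domb_term_small.
  by rewrite ltnS => /domb_term_Sn; left.
rewrite /domb_cert.
rewrite en1 en2 ?ek1 in d1 d2 d2' e1 e2 e3 *.
move: n%:R k%:R (domb_term _ _) (domb_term _ _) (domb_term _ _) (domb_term _ _)
  n1 n2 k1 d1 d2 d2' e1 e2 e3 {en1 en2 ek1} => N K g f0 f2 f1.
move=> n1 n2 k1 d1 d2 d2' e1 e2 e3.
(* Every term becomes a rational multiple of [f2], the term of index [n.+2], so the claim is an
   identity of rational functions in [N] and [K]. *)
have {e1} e1 : f1 =
    (N + 2 - K) ^+ 3 * f2 / (2 * (N + 2) ^+ 2 * (2 * (N + 2 - K) - 1)).
  by rewrite -e1; field; rewrite d2 n2.
have {e3} e3 : g = (N + 2 - K) ^+ 3 * (2 * K + 1) * f2 /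
    ((K + 1) ^+ 3 * (2 * (N + 2 - K) - 1)).
  by rewrite -e3; field; rewrite d2 k1.
have {e2} e2 : f0 =
    (N + 1 - K) ^+ 3 * f1 / (2 * (N + 1) ^+ 2 * (2 * (N + 1 - K) - 1)).
  case: e2 => [<-|[-> ->]]; last by rewrite mulr0 mul0r.
  by field; rewrite d1 n1.
rewrite e2 e3 e1; field.
by rewrite ?n2 ?n1 ?k1 ?d1 ?d2 ?d2'.
Qed.

(** Summands with [k > n] vanish, so the three Domb numbers of the recurrence can share one
    range. *)
Lemma Domb_sum n N : (n < N)%N ->
  (Domb n)%:R = \sum_(0 <= k < N) domb_term n k :> rat.
Proof.
move=> nN; rewrite (big_cat_nat _ nN) //=.
rewrite [X in _ + X]big_nat_cond [X in _ + X]big1 => [|k].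
  by rewrite addr0 big_mkord /Domb natr_sum.
by case/andP=> /andP[nk _] _; apply: domb_term_small.
Qed.

Lemma Domb_rec n :
  (n%:R + 2) ^+ 3 * (Domb n.+2)%:R
  - 2 * (2 * n%:R + 3) * (5 * (n%:R + 1) ^+ 2 + 5 * (n%:R + 1) + 2)
    * (Domb n.+1)%:R
  + 64 * (n%:R + 1) ^+ 3 * (Domb n)%:R = 0 :> rat.
Proof.
have dS i : (i < n.+3)%N ->
    (Domb i)%:R = \sum_(0 <= k < n.+3) domb_term i k :> rat.
  exact: Domb_sum.
rewrite !dS ?ltnS ?leqnSn ?leqW // !mulr_sumr -sumrB -big_split /=.
rewrite big_nat (eq_bigr (fun k => domb_cert n.+2 k.+1 - domb_cert n.+2 k)).
  (* Both ends vanish: at [k = n.+3] because of [domb_term], at [k = 0] because of the factor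
     [k ^ 3]. *)
  rewrite -big_nat telescope_sumr // /domb_cert.
  by rewrite domb_term_small // expr0n !mul0r mulr0 subrr.
by move=> k /andP[_ kn]; apply: domb_cert_telescope.
Qed.

(** * Exponential bounds on the Domb numbers *)

Lemma central_bin_le n : ('C(2 * n, n) <= 4 ^ n)%N.
Proof.
elim: n => // n IHn; rewrite -(leq_pmul2l (ltn0Sn n)) central_binS expnS.
nia.
Qed.

Lemma central_bin_ge n : (4 ^ n <= (2 * n + 1) * 'C(2 * n, n))%N.
Proof.
elim: n => // n IHn; rewrite expnS.
have := central_binS n; nia.
Qed.

Lemma sum_sqr_bin n : (\sum_(k < n.+1) 'C(n, k) ^ 2 = 'C(2 * n, n))%N.
Proof.
rewrite mul2n -addnn -binomial.Vandermonde; apply: eq_bigr => k _.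
by rewrite bin_sub ?mulnn // -ltnS.
Qed.

Lemma Domb_le n : (Domb n <= 16 ^ n)%N.
Proof.
rewrite -[16%N]/(4 * 4)%N expnMn; apply: (@leq_trans ('C(2 * n, n) * 4 ^ n)).
  rewrite -sum_sqr_bin big_distrl leq_sum //= => k _.
  have kn : (k <= n)%N by rewrite -ltnS.
  rewrite -mulnA -[X in (_ <= _ * 4 ^ X)%N](subnKC kn) expnD.
  by rewrite leq_mul // leq_mul ?central_bin_le.
by rewrite leq_mul2r central_bin_le orbT.
Qed.

(** Three central binomials are bounded below, two in each summand and one from [sum_sqr_bin]; each
    costs a factor of at most [2 * n + 1]. *)
Lemma Domb_ge n : (16 ^ n <= (2 * n + 1) ^ 3 * Domb n)%N.
Proof.
rewrite -[16%N]/(4 * 4)%N expnMn.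
apply: (@leq_trans ((2 * n + 1) * 'C(2 * n, n) * 4 ^ n)).
  by rewrite leq_mul2r central_bin_ge orbT.
rewrite [X in (_ <= X * _)%N]expnS -!mulnA leq_mul2l; apply/orP; right.
rewrite -sum_sqr_bin /Domb [leqRHS]mulnA [leqLHS]big_distrl [leqRHS]big_distrr /=.
apply: leq_sum => k _.
rewrite -[X in (_ <= _ * X)%N]mulnA [leqRHS]mulnCA leq_mul2l; apply/orP; right.
have kn : (k <= n)%N by rewrite -ltnS.
rewrite -[X in (4 ^ X <= _)%N](subnKC kn) expnD mulnACA.
apply: leq_mul; apply: (leq_trans (central_bin_ge _)); rewrite leq_mul2r; lia.
Qed.

(** * Growth of the terms and convergence of the series *)

Section Analysis.
Variable R : realType.


Lemma natmul_geometric_le (r : R) n : 0 <= r < 1 ->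
  n.+1%:R * r ^+ n <= (1 - r)^-1.
Proof.
case/andP=> r0 r1; have r1' : 0 < 1 - r by rewrite subr_gt0.
rewrite -[leRHS]mul1r ler_pdivlMr //.
(* The added [r ^+ n.+1] closes the induction: the next left side is [r] times the current one plus
   [(1 - r) * r ^+ n.+1]. *)
suff : r ^+ n.+1 + n.+1%:R * r ^+ n * (1 - r) <= 1.
  by apply: le_trans; rewrite lerDr exprn_ge0.
elim: n => [|n IHn]; first by rewrite expr1 expr0; lra.
have rn : r ^+ n.+1 <= 1 by rewrite exprn_ile1 // ltW.
rewrite -natr1 [r ^+ n.+2]exprS.
rewrite [in leRHS](_ : 1 = r * 1 + 1 * (1 - r)); last by ring.
apply: le_trans (lerD (ler_wpM2l r0 IHn) (ler_wpM2r (ltW r1') rn)).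
by rewrite le_eqVlt; apply/orP; left; apply/eqP; rewrite !exprS; ring.
Qed.

(** Of two factors [Num.sqrt q ^+ n], one absorbs a single [n.+1] and the other goes to the
    induction hypothesis. *)
Lemma natpow_geometric_bounded (q : R) k : 0 <= q < 1 ->
  exists M : R, forall n, n.+1%:R ^+ k * q ^+ n <= M.
Proof.
elim: k q => [|k IHk] q /andP[q0 q1].
  by exists 1 => n; rewrite mul1r exprn_ile1 // ltW.
have r01 : 0 <= Num.sqrt q < 1 by rewrite sqrtr_ge0 /= -sqrtr1 ltr_sqrt.
have [M HM] := IHk _ r01; set r := Num.sqrt q in r01 HM.
have r0 : 0 <= r by case/andP: r01.
exists (M * (1 - r)^-1) => n.
have -> : n.+1%:R ^+ k.+1 * q ^+ n =
    (n.+1%:R ^+ k * r ^+ n) * (n.+1%:R * r ^+ n).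
  by rewrite -(sqr_sqrtr q0) -/r exprAC expr2 exprSr; ring.
by rewrite ler_pM ?mulr_ge0 ?exprn_ge0 ?ler0n ?natmul_geometric_le.
Qed.

Lemma poly_natpow_bounded (f : {poly rat}) :
  exists C : R, forall n, `|ratr f.[n%:R]| <= C * n.+1%:R ^+ size f.
Proof.
exists (\sum_(i < size f) `|ratr f`_i|) => n.
rewrite horner_coef rmorph_sum mulr_suml /=.
apply: le_trans (ler_norm_sum _ _ _) (ler_sum _ _) => i _.
rewrite rmorphM rmorphXn /= ratr_nat normrM ler_wpM2l ?normr_ge0 //.
rewrite normrX normr_nat; apply: (@le_trans _ _ (n.+1%:R ^+ i)).
  by rewrite lerXn2r ?nnegrE ?ler0n ?ler_nat.
by rewrite ler_weXn2l ?ler1n // ltnW.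
Qed.

Definition domb_series_term (m : int) (f : {poly rat}) (n : nat) : R :=
  ratr f.[n%:R] * (Domb n)%:R / m%:~R ^+ n.

Lemma norm_domb_div (m : int) n :
  `|(Domb n)%:R / m%:~R ^+ n| = (Domb n)%:R / `|m|%:R ^+ n :> R.
Proof. by rewrite normrM normfV normrX normr_nat -intr_norm -natr_absz. Qed.

(** With [r] the square root of [16 / |m|], one factor [r ^+ n] absorbs the polynomial growth and
    the other remains as geometric majorant. *)
Lemma domb_series_term_le m f : (16 < `|m|)%N ->
  exists2 r : R, 0 <= r < 1 &
  exists M, forall n, `|domb_series_term m f n| <= M * r ^+ n.
Proof.
move=> m16; pose q : R := 16 / `|m|%:R.
have m0 : 0 < `|m|%:R :> R by rewrite ltr0n; apply: leq_trans m16.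
have q0 : 0 <= q by rewrite divr_ge0 ?ler0n.
have q1 : q < 1 by rewrite ltr_pdivrMr // mul1r ltr_nat.
have r01 : 0 <= Num.sqrt q < 1 by rewrite sqrtr_ge0 /= -sqrtr1 ltr_sqrt.
have [C HC] := poly_natpow_bounded f.
have [M HM] := natpow_geometric_bounded (size f) r01.
exists (Num.sqrt q) => //; exists (C * M) => n; set r := Num.sqrt q in r01 HM *.
have r0 : 0 <= r by case/andP: r01.
have C0 : 0 <= C.
  by apply: le_trans (normr_ge0 _) (le_trans (HC 0) _); rewrite expr1n mulr1.
rewrite /domb_series_term -mulrA normrM.
have qn : `|(Domb n)%:R / m%:~R ^+ n| <= r ^+ n * r ^+ n :> R.
  rewrite -exprMn -expr2 sqr_sqrtr // norm_domb_div.
  rewrite expr_div_n ler_wpM2r ?invr_ge0 ?exprn_ge0 ?ler0n //.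
  by rewrite -natrX ler_nat Domb_le.
apply: le_trans (ler_pM (normr_ge0 _) (normr_ge0 _) (HC n) qn) _.
rewrite mulrA ler_wpM2r ?exprn_ge0 // -mulrA ler_wpM2l //.
Qed.

Lemma cvg_domb_series m f : (16 < `|m|)%N -> cvgn (series (domb_series_term m f)).
Proof.
move=> m16; have [r /andP[r0 r1] [M HM]] := domb_series_term_le f m16.
apply: normed_cvg; apply: (series_le_cvg _ _ HM) => [n|n|]; first exact: normr_ge0.
  by apply: le_trans (normr_ge0 _) (HM n).
by apply: (@is_cvg_geometric_series R M); rewrite ger0_norm.
Qed.

Lemma affine_away_from0 (u v : rat) : (u != 0) || (v != 0) ->
  exists2 e : rat, 0 < e &
  exists N, forall n, (N <= n)%N -> e <= `|u * n%:R + v|.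
Proof.
have [->|u0] := eqVneq u 0 => /= uv.
  by exists `|v|; [rewrite normr_gt0 | exists 0%N => n _; rewrite mul0r add0r].
exists 1 => //; pose b := (1 + `|v|) / `|u|.
have b0 : 0 <= b by rewrite divr_ge0.
exists (Num.bound b) => n bn.
have {bn} : b <= n%:R.
  by apply: ltW; apply: lt_le_trans (archi_boundP b0) _; rewrite ler_nat.
rewrite ler_pdivrMr ?normr_gt0 // => bn.
rewrite -[v]opprK; apply: le_trans (lerB_dist _ _).
by rewrite normrN normrM normr_nat lerBrDr mulrC.
Qed.

(** Otherwise [|m| <= 15], and by [Domb_ge] the terms are eventually at least a positive constant
    times [(16 / 15) ^ n / (n + 1) ^ 3], whereas terms of a convergent series are bounded. *)
Lemma domb_series_cvg_gt16 (m : int) (u v : rat) : (u != 0) || (v != 0) ->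
  m != 0 -> (`|m| != 16)%N ->
  cvgn (series (domb_series_term m (u *: 'X + v%:P))) -> (16 < `|m|)%N.
Proof.
move=> uv m0 m16 /cvg_series_cvg_0 /cvgP /cvg_seq_bounded /pinfty_ex_gt0[M M0 HM].
rewrite ltn_neqAle eq_sym m16 /= leqNgt; apply/negP => mlt.
have [e e0 [N HN]] := affine_away_from0 uv.
have q01 : (0 <= 15 / 16 :> R) && (15 / 16 < 1 :> R) by apply/andP; split; lra.
(* The exponent 4 covers the cube from [Domb_ge] and one further [n.+1], whose resulting bound is
   absurd. *)
have [K HK] := natpow_geometric_bounded 4 q01.
have K0 : 0 <= K by apply: le_trans (HK 0); rewrite expr1n mulr1.
have er0 : 0 < ratr e :> R by rewrite ltr0q.
suff H n : (N <= n)%N -> n.+1%:R <= M * 8 * K / ratr e.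
  have B0 : 0 <= M * 8 * K / ratr e.
    by apply: divr_ge0 (ltW er0); rewrite !mulr_ge0 ?ler0n ?(ltW M0).
  have := H _ (leq_maxl N (Num.bound (M * 8 * K / ratr e))).
  rewrite leNgt => /negP; apply; apply: lt_le_trans (archi_boundP B0) _.
  by rewrite ler_nat ltnW // ltnS leq_maxr.
move=> Nn; rewrite ler_pdivlMr //.
have am : 0 < `|m|%:R :> R by rewrite ltr0n absz_gt0.
have t1 : ratr e * ((Domb n)%:R / `|m|%:R ^+ n) <= M.
  apply: le_trans (HM n I); rewrite /domb_series_term -mulrA normrM norm_domb_div.
  rewrite ler_wpM2r ?divr_ge0 ?exprn_ge0 ?ler0n //.
  by rewrite !hornerE -ratr_norm ler_rat HN.
have t2 : (16 / 15) ^+ n <= 8 * n.+1%:R ^+ 3 * ((Domb n)%:R / `|m|%:R ^+ n) :> R.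
  rewrite mulrA ler_pdivlMr ?exprn_gt0 //.
  apply: (@le_trans _ _ (16 ^+ n)).
    rewrite expr_div_n mulrAC ler_pdivrMr ?exprn_gt0 // ler_wpM2l ?exprn_ge0 //.
    by rewrite lerXn2r ?nnegrE ?ler0n // ler_nat -ltnS.
  have : (16 ^ n)%:R <= ((2 * n.+1) ^ 3 * Domb n)%:R :> R.
    rewrite ler_nat; apply: leq_trans (Domb_ge n) _.
    by rewrite leq_mul2r leq_exp2r // mulnS; apply/orP; right; lia.
  by rewrite natrM !natrX natrM exprMn; congr (_ <= _); ring.
have q0 : 0 <= (15 / 16) ^+ n :> R by rewrite exprn_ge0 //; lra.
have pq : (16 / 15) ^+ n * (15 / 16) ^+ n = 1 :> R.
  by rewrite -exprMn (_ : 16 / 15 * (15 / 16) = 1) ?expr1n //; field.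
move: t1 t2 (HK n) q0 pq.
move: (_ / `|m|%:R ^+ n) ((16 / 15) ^+ n) ((15 / 16) ^+ n) => x p q t1 t2 t3 q0 pq.
apply: (@le_trans _ _ (M * 8 * (n.+1%:R ^+ 4 * q))); last first.
  by rewrite ler_wpM2l // mulr_ge0 // ltW.
have -> : n.+1%:R * ratr e = n.+1%:R * q * (ratr e * p).
  by transitivity (n.+1%:R * ratr e * (p * q)); [rewrite pq mulr1 | ring].
have -> : M * 8 * (n.+1%:R ^+ 4 * q) = n.+1%:R * q * (8 * n.+1%:R ^+ 3 * M) by ring.
have nq0 : 0 <= n.+1%:R * q by rewrite mulr_ge0.
apply: (ler_wpM2l nq0); apply: (@le_trans _ _ (ratr e * (8 * n.+1%:R ^+ 3 * x))).
  exact: (ler_wpM2l (ltW er0)).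
by rewrite mulrCA ler_wpM2l // mulr_ge0 ?exprn_ge0.
Qed.
End Analysis.

(* The formal adjoint of the recurrence: [domb_up], [domb_mid] and [domb_down]
   carry the terms in D(n+2), D(n+1) and D(n), reindexed to D(n), so that summing
   the recurrence against x gives \sum_n (domb_adjoint x).[n] D(n) / m ^ n = 0. *)
Section Adjoint.

Let X1E : 'X + 1%:P = 'X - (-1)%:P :> {poly rat}.
Proof. by rewrite polyCN opprK. Qed.

Variable m : int.
Let z : rat := m%:~R.

Definition domb_up (x : {poly rat}) : {poly rat} :=
  (z ^+ 2) *: ('X^3 * (x \Po ('X - 1%:P))).
Definition domb_mid (x : {poly rat}) : {poly rat} :=
  (2 * z) *: (Poly [:: 2; 9; 15; 10] * x).
Definition domb_down (x : {poly rat}) : {poly rat} :=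
  64%:R *: (('X + 1%:P) ^+ 3 * (x \Po ('X + 1%:P))).

Lemma horner_up x t : (domb_up x).[t] = z ^+ 2 * (t ^+ 3 * x.[t - 1]).
Proof. by rewrite /domb_up hornerZ hornerM hornerXn horner_comp hornerXsubC. Qed.

Lemma horner_mid x t :
  (domb_mid x).[t] = 2 * z * (2 * t + 1) * (5 * t ^+ 2 + 5 * t + 2) * x.[t].
Proof. by rewrite /domb_mid hornerZ hornerM horner_Poly /=; ring. Qed.

Lemma horner_down x t :
  (domb_down x).[t] = 64 * ((t + 1) ^+ 3 * x.[t + 1]).
Proof.
by rewrite /domb_down hornerZ hornerM horner_exp horner_comp hornerD hornerX hornerC.
Qed.

Definition domb_adjoint x := domb_up x - domb_mid x + domb_down x.

Lemma domb_adjoint0 : domb_adjoint 0 = 0.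
Proof.
rewrite /domb_adjoint /domb_up /domb_mid /domb_down !comp_poly0 !mulr0 !scaler0.
by rewrite subr0 addr0.
Qed.

Lemma size_domb_adjoint d : (size (domb_adjoint 'X^d) <= d.+4)%N.
Proof.
have X1 (c : rat) : size (('X - c%:P) ^+ d) = d.+1 by rewrite size_exp_XsubC.
have X3 (c : rat) : size (('X - c%:P) ^+ 3) = 4 by rewrite size_exp_XsubC.
rewrite /domb_adjoint /domb_up /domb_mid /domb_down !comp_Xn_poly X1E.
have sM (p q : {poly rat}) a b :
    (size p <= a.+1)%N -> (size q <= b.+1)%N -> (size (p * q)%R <= (a + b).+1)%N.
  by move=> ? ?; apply: leq_trans (size_polyMleq _ _) _; lia.
rewrite (leq_trans (size_polyD _ _)) // geq_max; apply/andP; split.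
  rewrite (leq_trans (size_polyD _ _)) // geq_max size_polyN; apply/andP; split.
    apply: leq_trans (size_scale_leq _ _) _.
    apply: (leq_trans (sM _ _ 3 d _ _)); rewrite ?size_polyXn ?X1 //; lia.
  apply: leq_trans (size_scale_leq _ _) _.
  apply: (leq_trans (sM _ _ 3 d _ _));
    rewrite ?size_polyXn ?(size_Poly [:: _; _; _; _]) //; lia.
apply: leq_trans (size_scale_leq _ _) _.
by apply: (leq_trans (sM _ _ 3 d _ _)); rewrite ?X1 ?X3 //; lia.
Qed.

(** The three parts contribute [z ^+ 2], [- 20 * z] and [64]. *)
Lemma coef_domb_adjoint d : (domb_adjoint 'X^d)`_d.+3 = (z - 4) * (z - 16).
Proof.
have mon (p : {poly rat}) : p \is monic -> size p = d.+4 -> p`_d.+3 = 1.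
  by move=> /monicP <- sp; rewrite lead_coefE sp.
have XM (c : rat) k : ('X - c%:P) ^+ k \is monic by rewrite monic_exp ?monicXsubC.
rewrite /domb_adjoint /domb_up /domb_mid /domb_down !comp_Xn_poly X1E.
rewrite !coefD coefN !coefZ.
rewrite (mon ('X^3 * _)); first last.
- by rewrite size_monicM ?monicXn ?monic_neq0 // size_polyXn size_exp_XsubC.
- by rewrite monicMl ?monicXn.
rewrite -exprD (mon (_ ^+ (3 + d))) ?size_exp_XsubC //.
have -> : (Poly [:: 2; 9; 15; 10] * 'X^d : {poly rat})`_d.+3 = 10.
  rewrite coefMXn ifF; last by lia.
  by have -> : (d.+3 - d = 3)%N; [lia | rewrite coef_Poly].
by rewrite /=; ring.
Qed.
End Adjoint.

(** * The summation functional and reduction modulo its kernel *)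

Section Functional.
Variables (R : realType) (m : int).
Implicit Types f g : {poly rat}.

Definition domb_sums f (a : R) := series (domb_series_term R m f) @ \oo --> a.

Lemma domb_series_termE f n : domb_series_term R m f n =
  ratr (f.[n%:R] * (Domb n)%:R / m%:~R ^+ n).
Proof.
by rewrite /domb_series_term !rmorphM fmorphV rmorphXn /= ratr_nat ratr_int.
Qed.

Lemma domb_sums_lin (c : rat) f g a b : domb_sums f a -> domb_sums g b ->
  domb_sums (c *: f + g) (ratr c * a + b).
Proof.
move=> fa gb; rewrite /domb_sums.
have -> : series (domb_series_term R m (c *: f + g)) =
    (fun n => ratr c * series (domb_series_term R m f) n +
              series (domb_series_term R m g) n).
  apply/funext => n; rewrite !seriesEnat /= mulr_sumr -big_split /=.
  apply: eq_bigr => k _; rewrite !domb_series_termE -rmorphM -rmorphD hornerD hornerZ.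
  by congr ratr; ring.
by apply: cvgD => //; apply: cvgM fa; apply: cvg_cst.
Qed.

(** By the recurrence the contributions of each value of [x] cancel once all of them lie in the
    partial sum; only boundary terms survive. *)
Lemma domb_series_adjoint (x : {poly rat}) n : m != 0 ->
  series (domb_series_term R m (domb_adjoint m x)) n.+1 =
  domb_series_term R m (domb_down x) n - domb_series_term R m (domb_up m x) n.+1.
Proof.
move=> m0; have z0 : m%:~R != 0 :> rat by rewrite intr_eq0.
rewrite seriesEnat /=; elim: n => [|n IHn].
  rewrite big_nat1 !domb_series_termE -rmorphB; congr ratr.
  rewrite !(hornerD, hornerN) !(horner_up, horner_mid, horner_down).
  (* The base case is the recurrence at [n = -1], which reads [Domb 1 = 4 * Domb 0]. *)
  have -> : Domb 0 = 1%N by rewrite /Domb !big_ord_recr !big_ord0.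
  have -> : Domb 1 = 4%N by rewrite /Domb !big_ord_recr !big_ord0.
  by rewrite subrr add0r expr1n; field.
rewrite big_nat_recr //= IHn !domb_series_termE -!rmorphB -rmorphD; congr ratr.
apply/eqP; rewrite -subr_eq0; apply/eqP.
rewrite !(hornerD, hornerN) !(horner_up, horner_mid, horner_down).
have en1 : n.+1%:R = n%:R + 1 :> rat by rewrite natr1.
have en2 : n.+2%:R = n%:R + 2 :> rat by rewrite -natrD addn2.
have ex1 : n%:R + 2 - 1 = n%:R + 1 :> rat by ring.
rewrite en1 en2 ex1 !exprS.
transitivity (x.[n%:R + 1] / m%:~R ^+ n * 0); last by rewrite mulr0.
rewrite -(Domb_rec n); field.
by rewrite expf_neq0 z0.
Qed.

Hypothesis m16 : (16 < `|m|)%N.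

(** Both boundary terms in [domb_series_adjoint] are terms of convergent series, hence tend to
    zero. *)
Lemma domb_sums_adjoint x : domb_sums (domb_adjoint m x) 0.
Proof.
have m0 : m != 0 by rewrite -absz_gt0; apply: leq_trans m16.
have t0 f : domb_series_term R m f @ \oo --> (0 : R).
  exact/cvg_series_cvg_0/cvg_domb_series.
rewrite /domb_sums -cvg_shiftS.
have -> : [sequence series (domb_series_term R m (domb_adjoint m x)) n.+1]_n =
    domb_series_term R m (domb_down x) -
    (fun n => domb_series_term R m (domb_up m x) n.+1).
  by apply/funext => n; exact: domb_series_adjoint.
have tS : (fun n => domb_series_term R m (domb_up m x) n.+1) @ \oo --> (0 : R).
  by have := t0 (domb_up m x); rewrite -cvg_shiftS.
by have := cvgB (t0 (domb_down x)) tS; rewrite subr0; apply.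
Qed.

Lemma domb_reduce f : exists2 g : {poly rat}, (size g <= 3)%N & domb_sums (f - g) 0.
Proof.
have [k] := ubnP (size f); elim: k f => // k IHk f; rewrite ltnS => fk.
have [f3|] := leqP (size f) 3.
  exists f => //; rewrite subrr.
  by have := domb_sums_adjoint 0; rewrite domb_adjoint0.
case def_d : (size f) => [|[|[|[|d]]]] // _.
pose z : rat := m%:~R; pose l := (z - 4) * (z - 16).
have l0 : l != 0.
  by rewrite mulf_neq0 // subr_eq0 /z pmulrn eqr_int;
  apply: contraTneq m16 => ->.
(* [c] is chosen to cancel the top coefficient of [f]; [l] is nonzero because [m] is neither 4 nor
   16. *)
pose c := f`_d.+3 / l; pose h := domb_adjoint m 'X^d.
have fh : (size (f - c *: h)%R < size f)%N.
  rewrite def_d ltnS; apply/leq_sizeP => j; rewrite leq_eqVlt => /predU1P[<-|dj].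
    by rewrite coefB coefZ coef_domb_adjoint -/z -/l divfK ?subrr.
  rewrite coefB coefZ !nth_default ?mulr0 ?subrr ?def_d //.
  exact: leq_trans (size_domb_adjoint _ _) dj.
have [g g3 gP] := IHk (f - c *: h) (leq_trans fh fk).
exists g => //; have := domb_sums_lin (c := c) (domb_sums_adjoint 'X^d) gP.
rewrite mulr0 addr0; congr domb_sums; rewrite -/h; ring.
Qed.
End Functional.

(** * Linear dependence and the construction of [Q] *)

Lemma left_kernel_neq0 (F : fieldType) p q (A : 'M[F]_(p, q)) :
  (q < p)%N -> exists2 w : 'rV_p, w != 0 & w *m A = 0.
Proof.
move=> qp; exists (nz_row (kermx A)); last by apply/sub_kermxP/nz_row_sub.
rewrite nz_row_eq0 -mxrank_eq0 mxrank_ker subn_eq0 -ltnNge.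
exact: leq_ltn_trans (rank_leq_col _) qp.
Qed.

Theorem theorem2 (R : realType) (m : int) (u v : rat) (lambda : R)
  (m_neq0 : m != 0) (m_neq16 : `|m| != 16)
  (uv_neq0 : (u != 0) || (v != 0))
  (Domb_series :
    series (fun n : nat =>
      ratr (u * n%:R + v) * (Domb n)%:R / m%:~R ^+ n : R) @ \oo
      --> lambda / pi)
  (P : {poly rat}) (P_nonconst : (1 < size P)%N) :
  exists (Q : {poly rat}) (c : rat),
    [/\ Q != 0, (size Q <= 3)%N &
      series (fun n : nat =>
        ratr (P.[n%:R] * Q.[n%:R]) * (Domb n)%:R / m%:~R ^+ n : R) @ \oo
        --> ratr c * lambda / pi].
Proof.
pose w := u *: 'X + v%:P : {poly rat}.
have w_sums : domb_sums m w (lambda / pi).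
  rewrite /domb_sums /domb_series_term.
  by under eq_fun do rewrite !hornerE.
have m16 : (16 < `|m|)%N.
  apply: (domb_series_cvg_gt16 uv_neq0 m_neq0 _ (cvgP _ w_sums)).
  by rewrite -eqz_nat abszE.
have w0 : w != 0.
  apply: contraTneq uv_neq0 => w0; rewrite negb_or !negbK.
  have := congr1 (fun p : {poly rat} => p`_0) w0.
  have := congr1 (fun p : {poly rat} => p`_1) w0.
  by rewrite !coefE /= ?(mulr0, mulr1, add0r, addr0) => -> ->; rewrite eqxx.
have w3 : (size w <= 3)%N.
  by apply/leq_sizeP => -[|[|[|j]]] // _; rewrite !coefE /= mulr0 addr0.
clearbody w.
have [g0 g03 g0P] := domb_reduce R m16 P.
have [g1 g13 g1P] := domb_reduce R m16 (P * 'X).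
have [g2 g23 g2P] := domb_reduce R m16 (P * 'X^2).
pose h := [:: g0; g1; g2; w].
have [r r0 rA] := left_kernel_neq0 (\matrix_(i < 4, j < 3) (h`_i)`_j) isT.
pose a i := r 0 (inord i : 'I_4).
have rE : a 0 *: g0 + a 1 *: g1 + a 2 *: g2 + a 3 *: w = 0.
  apply/polyP => j; rewrite coef0; have [j3|j3] := ltnP j 3; last first.
    by rewrite !coefD !coefZ !(nth_default 0 (leq_trans _ j3)) // !mulr0 !addr0.
  have := congr1 (fun M : 'rV_3 => M 0 (Ordinal j3)) rA.
  have aE (i : 'I_4) : r 0 i = a i by rewrite /a inord_val.
  by rewrite !mxE !big_ord_recr big_ord0 /= !mxE /= add0r !aE !coefD !coefZ.
pose Q := a 0 *: 1 + a 1 *: 'X + a 2 *: 'X^2.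
(* Modulo the kernel [P * Q] is [a 0 *: g0 + a 1 *: g1 + a 2 *: g2], which [rE] equates with
   [- a 3 *: w]. *)
exists Q, (- a 3); split.
(* If [Q] vanished, so would [a 0], [a 1], [a 2], and then [a 3] because [w] is nonzero, against
   [r != 0]. *)
- apply: contraNneq r0 => Q0.
  have QE i : Q`_i = 0 by rewrite Q0 coef0.
  have a0 := QE 0; have a1 := QE 1; have a2 := QE 2.
  rewrite !coefE /= ?(mulr0, mulr1, add0r, addr0) in a0 a1 a2.
  move/eqP: rE; rewrite a0 a1 a2 !scale0r !add0r scaler_eq0 (negPf w0) orbF => /eqP a3.
  apply/eqP/rowP => i; rewrite mxE -[i]inord_val -/(a i).
  by case: i => -[|[|[|[|]]]].
- by apply/leq_sizeP => -[|[|[|j]]] // _; rewrite !coefE /= !mulr0 !addr0.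
(* [domb_adjoint m 0], which is zero, fills the innermost summand that [domb_sums_lin] asks for. *)
have := domb_sums_lin (c := a 0) g0P (domb_sums_lin (c := a 1) g1P
  (domb_sums_lin (c := a 2) g2P
  (domb_sums_lin (c := - a 3) w_sums (domb_sums_adjoint (R := R) m16 0)))).
rewrite !mulr0 !add0r addr0 -[ratr (- a 3) * lambda / pi]mulrA.
rewrite domb_adjoint0 addr0 (_ : _ + _ = P * Q); last first.
  transitivity (P * Q - (a 0 *: g0 + a 1 *: g1 + a 2 *: g2 + a 3 *: w));
    last by rewrite rE subr0.
  by rewrite /Q -!mul_polyC; rewrite polyCN; ring.
rewrite /domb_sums /domb_series_term.
by under eq_fun do rewrite hornerM.
Qed.
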